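(* Let $E_1,E_2,\dots$ be a sequence of non-empty complete metric spaces with uniformly bounded diameters; the distance on each of them is denoted $d$. Let $P_k:E_k\to E_{k-1}$, $k\ge2$, be a sequence of uniformly contracting mappings: there exists a $\lambda$, $0<\lambda<1$, such that $d(P_k(x),P_k(y))<\lambda d(x,y)$ for every distinct $x,y\in E_k$ and every $k\geq2$. Then there exists a unique sequence of points $x_k\in E_k$ such that $x_{k-1}=P_k(x_k)$ for all $k\geq2$. For every $k\ge2$ one has $$x_{k-1}=\lim_{m\to\infty}P_k\circ\dots\circ P_m(x),$$ and the convergence is uniform in $x$: for every $\varepsilon>0$ there exists some $l\in\mathbb N$ such that for every $m\geq l$ and every $x\in E_m$ one has $d(P_k\circ\dots\circ P_m(x),x_{k-1})<\varepsilon$. If in addition the spaces $E_k$ coincide with one and the same space $E$ and the fixed points of the mappings $P_k$ tend to some $x_{\infty}\in E$, as $k\to\infty$, then $\lim_{k\to\infty}x_k=x_{\infty}$. *)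

(* Defs.v *)
From HB Require Import structures.
From mathcomp Require Import all_boot all_order all_algebra.
From mathcomp Require Import all_classical all_reals all_analysis.

Set Implicit Arguments.
Unset Strict Implicit.
Unset Printing Implicit Defensive.

Import Order.TTheory GRing.Theory Num.Theory.

Local Open Scope classical_set_scope.
Local Open Scope ring_scope.

(* Non-emptiness is part of the structure: [Complete] requires a pointed type. *)
#[short(type="completeMetricType")]
HB.structure Definition CompleteMetric (K : numDomainType) :=
  { T of Complete T & Metric K T }.

Section ContractingSequences.
Context {R : realType}.

Definition diameter (T : metricType R) : \bar R :=
  ereal_sup [set (mdist p.1 p.2)%:E | p in [set: T * T]].

(* Spaces and maps numbered from 1 and 2 respectively are shifted to start at
   0: [E k] stands for E_{k+1} and [P k : E k.+1 -> E k] for P_{k+2}. *)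
Variable E : nat -> completeMetricType R.

Definition uniformly_bounded_diameters : Prop :=
  exists M : R, forall k, (diameter (E k) <= M%:E)%E.

Variable P : forall k, E k.+1 -> E k.

Definition uniformly_contracting : Prop :=
  exists2 lambda : R, 0 < lambda < 1 &
    forall k (x y : E k.+1), x <> y ->
      mdist (P x) (P y) < lambda * mdist x y.

Definition coherent (x : forall k, E k) : Prop :=
  forall k, x k = P (x k.+1).

(* [iterated_map k n] is the composite P k \o P k.+1 \o ... \o P (n + k).-1
   of n maps. *)
Fixpoint iterated_map (k n : nat) : E (n + k) -> E k :=
  match n return E (n + k) -> E k with
  | 0 => fun x => x
  | n'.+1 => fun x => iterated_map (P x)
  end.

End ContractingSequences.

Arguments diameter {R} T.
Arguments uniformly_bounded_diameters {R} E.
Arguments uniformly_contracting {R E} P.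
Arguments coherent {R E} P x.
Arguments iterated_map {R E} P k n x.

(* Main.v *)
(* The composite of n maps contracts by r ^+ n, so its image has diameter at
   most M * r ^+ n; the images of E (n + k) in E k are nested, and x k is their
   common limit point by completeness.  If P k fixes p k --> a, then
   d(x k, a) <= 2 d(p k, a) + r d(x k.+1, a); iterating this forward from a large
   k, with the last term bounded by M, gives x k --> a. *)
Require Import Defs.
From mathcomp Require Import all_boot all_order all_algebra.
From mathcomp Require Import all_classical all_reals all_analysis.
From mathcomp Require Import ring lra.

Set Implicit Arguments.
Unset Strict Implicit.
Unset Printing Implicit Defensive.

Import Order.TTheory GRing.Theory Num.Theory.

Local Open Scope classical_set_scope.
Local Open Scope ring_scope.

Lemma mdist_le_diameter (R : realType) (T : metricType R) (M : R) (x y : T) :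
  (diameter T <= M%:E)%E -> mdist x y <= M.
Proof.
move=> TM; rewrite -lee_fin; apply: le_trans TM.
by apply: ereal_sup_ubound; exists (x, y).
Qed.

Lemma geometric_lt (R : realType) (a r e : R) : 0 < r < 1 -> 0 < e ->
  exists N, forall n, (N <= n)%N -> a * r ^+ n < e.
Proof.
move=> /andP[r0 r1] e0.
have r1' : `|r| < 1 by rewrite gtr0_norm.
have /cvgr0_norm_lt /(_ e e0)[N _ Nr] := cvg_geometric a r1'.
by exists N => n /Nr; apply: le_lt_trans; exact: ler_norm.
Qed.

Lemma le_add_geometric (R : realType) (a r b c : R) : 0 < r < 1 ->
  (forall n, b <= c + a * r ^+ n) -> b <= c.
Proof.
move=> r01 bc; apply/ler_addgt0Pr => e e0.
have [N /(_ N (leqnn N)) aN] := geometric_lt a r01 e0.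
by rewrite (le_trans (bc N))// lerD2l ltW.
Qed.

Lemma contracting_le (R : realType) (T U : metricType R) (f : T -> U) (r : R) :
  (forall x y, x <> y -> mdist (f x) (f y) < r * mdist x y) ->
  forall x y, mdist (f x) (f y) <= r * mdist x y.
Proof.
move=> fr x y; have [->|/eqP /fr/ltW//] := eqVneq x y.
by rewrite !mdistxx mulr0.
Qed.

Section IteratedMaps.
Context {R : realType} (E : nat -> completeMetricType R).
Variable P : forall k, E k.+1 -> E k.
Variables r M : R.
Hypothesis r01 : 0 < r < 1.
Hypothesis Pr : forall k (x y : E k.+1), mdist (P x) (P y) <= r * mdist x y.
Hypothesis EM : forall k (x y : E k), mdist x y <= M.

Let r_ge0 : 0 <= r. Proof. by case/andP: r01 => /ltW. Qed.

Lemma iterated_map_le k n (y z : E (n + k)) :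
  mdist (iterated_map P k n y) (iterated_map P k n z) <= M * r ^+ n.
Proof.
(* The induction must carry the distance itself: with [M] in its place the factor [r] gained by the
   innermost map would be lost. *)
suff: mdist (iterated_map P k n y) (iterated_map P k n z) <= mdist y z * r ^+ n.
  by move=> /le_trans; apply; rewrite ler_wpM2r ?exprn_ge0.
elim: n y z => [|n IHn] y z /=; first by rewrite expr0 mulr1.
rewrite (le_trans (IHn _ _))// exprS mulrA ler_wpM2r ?exprn_ge0//.
by rewrite mulrC Pr.
Qed.

(** This is the nesting of the images in [E k]: [z] is what the [m - n] innermost maps make of
    [y]. *)
Lemma iterated_map_factor k n m (y : E (m + k)) : (n <= m)%N ->
  exists z : E (n + k), iterated_map P k m y = iterated_map P k n z.
Proof.
elim: m y => [|m IHm] y; first by rewrite leqn0 => /eqP->; exists y.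
rewrite leq_eqVlt => /predU1P[->|]; first by exists y.
by rewrite ltnS => /(IHm (P y))[z yz]; exists z.
Qed.

(* The two sides start from [E (n.+1 + k)] and [E (n + k.+1)], which are only
   propositionally equal. *)
Lemma iterated_mapSl k n (e : (n + k).+1 = (n + k.+1)%N) (y : E (n + k).+1) :
  iterated_map P k n.+1 y = P (iterated_map P k.+1 n (eq_rect _ E y _ e)).
Proof.
elim: n e y => [|n IHn] e y; first by rewrite (eq_irrelevance e erefl).
have P_cast a b (ab : a = b) (z : E a.+1) :
  P (eq_rect _ E z _ (congr1 succn ab)) = eq_rect _ E (P z) _ ab.
  by case: _ / ab.
have e' : (n + k).+1 = (n + k.+1)%N by rewrite addnS.
(* Equality proofs in [nat] are unique, so [e] may be taken of the form along which transport
   commutes with [P]. *)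
rewrite (eq_irrelevance e (congr1 succn e')).
change (iterated_map P k n.+1 (P y) = P (iterated_map P k.+1 n
  (P (eq_rect _ E y _ (congr1 succn e'))))).
by rewrite (IHn e') P_cast.
Qed.

Lemma coherent_iterated_map (x : forall k, E k) : coherent P x ->
  forall k n, x k = iterated_map P k n (x (n + k)%N).
Proof. by move=> xP k; elim=> //= n ->; rewrite (xP (n + k)%N). Qed.

Lemma coherent_le (x : forall k, E k) : coherent P x ->
  forall k n (y : E (n + k)), mdist (iterated_map P k n y) (x k) <= M * r ^+ n.
Proof.
move=> xP k n y; rewrite (coherent_iterated_map xP k n).
exact: iterated_map_le.
Qed.

(** For every [n], [x k] is an image of a point of [E (n + k)], hence within [M * r ^+ n] of
    [x' k]. *)
Lemma coherent_unique (x x' : forall k, E k) :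
  coherent P x -> coherent P x' -> x = x'.
Proof.
move=> xP x'P; apply: functional_extensionality_dep => k.
apply: mdist_positivity; apply/eqP; rewrite eq_le mdist_ge0 andbT.
apply: (le_add_geometric (a := M) r01) => n; rewrite add0r.
rewrite (coherent_iterated_map xP k n); exact: coherent_le.
Qed.

Lemma iterated_map_limit k : exists x : E k,
  forall n (y : E (n + k)), mdist (iterated_map P k n y) x <= M * r ^+ n.
Proof.
(* The starting points are arbitrary; by nesting, every later [u m] lies in the image of
   [E (n + k)]. *)
pose u n := iterated_map P k n point.
have uE n m (y : E (n + k)) : (n <= m)%N ->
    mdist (iterated_map P k n y) (u m) <= M * r ^+ n.
  move=> /(@iterated_map_factor k n m point)[z]; rewrite /u => ->.
  exact: iterated_map_le.
have cvu : cvg (u @ \oo).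
  apply/cauchy_cvgP/cauchy_exP => e e0.
  have [N /(_ N (leqnn N)) aN] := geometric_lt M r01 e0.
  exists (u N); exists N => // m /= Nm.
  by rewrite ballEmdist/= (le_lt_trans _ aN)// uE.
exists (lim (u @ \oo)) => n y; apply/ler_addgt0Pr => e e0.
have /metricType_numDomainType.cvgrPdist_lt /(_ e e0)[N _ Nu] := cvu.
have := Nu (maxn n N) (leq_maxr _ _).
(* This index makes [u m] close to the limit and still in the image of [E (n + k)]. *)
set m := maxn n N => /= me.
rewrite (le_trans (metric_triangle _ (u m) _))// lerD ?uE ?leq_maxl//.
by rewrite metric_sym ltW.
Qed.

Lemma coherent_exists : exists x : forall k, E k, coherent P x.
Proof.
pose x k := xget point [set x : E k |
  forall n (y : E (n + k)), mdist (iterated_map P k n y) x <= M * r ^+ n].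
have xP k n (y : E (n + k)) : mdist (iterated_map P k n y) (x k) <= M * r ^+ n.
  by apply: (xgetPex point (iterated_map_limit k)).
exists x => k; apply: mdist_positivity; apply/eqP.
rewrite eq_le mdist_ge0 andbT.
(* With [z] the image of [point] in [E k.+1], both [x k] and [P (x k.+1)] are within [M * r ^+ n.+1]
   of [P z]. *)
apply: (le_add_geometric (a := M * r *+ 2) r01) => n; rewrite add0r.
have e : (n + k).+1 = (n + k.+1)%N by rewrite addnS.
have := xP k n.+1 point; rewrite (iterated_mapSl e) metric_sym.
set z := iterated_map P k.+1 n _ => xz.
rewrite (le_trans (metric_triangle _ (P z) _))// mulrnAl mulr2n -mulrA -exprS.
rewrite lerD// (le_trans (Pr _ _))// exprS mulrCA ler_wpM2l//.
exact: xP.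
Qed.

End IteratedMaps.

Lemma coherent_cvg_fixpoints (R : realType) (E : completeMetricType R)
    (P : nat -> E -> E) (r M : R) (x p : nat -> E) (a : E) : 0 < r < 1 ->
  (forall k u v, mdist (P k u) (P k v) <= r * mdist u v) ->
  (forall u v : E, mdist u v <= M) ->
  (forall k, x k = P k (x k.+1)) -> (forall k, P k (p k) = p k) ->
  p k @[k --> \oo] --> a -> x k @[k --> \oo] --> a.
Proof.
move=> r01 Pr EM xP pP pa; have /andP[r0 r1] := r01.
apply/metricType_numDomainType.cvgrPdist_lt => e e0.
(* The choice of [d] makes [c] the fixed point of [t |-> 2 d + r t], the recursion linking the
   bounds at [k.+1] and [k]; halving [e] leaves room for a strict inequality. *)
pose c := e / 2; pose d := c * (1 - r) / 2.
have d0 : 0 < d by rewrite !(divr_gt0, mulr_gt0)// subr_gt0.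
have /metricType_numDomainType.cvgrPdist_lt /(_ d d0)[N _ Np] := pa.
exists N => // k /= Nk.
suff xc : mdist a (x k) <= c.
  by rewrite (le_lt_trans xc)// ltr_pdivrMr// ltr_pMr// ltr1n.
apply: (le_add_geometric (a := M) r01) => n.
(* [k] stays general because the bound at [k] comes from the one at [k.+1], with one step fewer. *)
elim: n k Nk => [|n IHn] k Nk.
  by rewrite expr0 mulr1 (le_trans (EM _ _))// lerDr divr_ge0// ltW.
have apk : mdist a (p k) <= d by exact/ltW/Np.
have axk := IHn _ (leqW Nk).
have pxk : mdist (p k) (x k) <= r * (mdist a (p k) + mdist a (x k.+1)).
  rewrite -{1}pP [x k]xP (le_trans (Pr _ _ _))// ler_pM2l//.
  by rewrite (le_trans (metric_triangle _ a _))// (metric_sym (p k)).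
have := metric_triangle a (p k) (x k).
have : r * (mdist a (p k) + mdist a (x k.+1)) <= d + r * (c + M * r ^+ n).
  rewrite mulrDr lerD ?ler_pM2l//.
  by rewrite (le_trans _ apk)// ler_piMl ?mdist_ge0// ltW.
have -> : c + M * r ^+ n.+1 = d + (d + r * (c + M * r ^+ n)).
  by rewrite /d exprS; field.
lra.
Qed.

Theorem theorem1p17 (R : realType) :
  (forall (E : nat -> completeMetricType R) (P : forall k, E k.+1 -> E k),
    uniformly_bounded_diameters E -> uniformly_contracting P ->
    (exists! x : forall k, E k, coherent P x) /\
    (forall x : forall k, E k, coherent P x -> forall k : nat,
      (forall y : forall m, E m,
        iterated_map P k n (y (n + k)%N) @[n --> \oo] --> x k) /\
      (forall eps : R, 0 < eps ->
        exists l : nat, forall n : nat, (l <= n + k)%N ->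
          forall y : E (n + k)%N, mdist (iterated_map P k n y) (x k) < eps)))
  /\
  (forall (E : completeMetricType R) (P : nat -> E -> E),
    uniformly_bounded_diameters (fun=> E) ->
    uniformly_contracting (E := fun=> E) P ->
    forall x : nat -> E, coherent (E := fun=> E) P x ->
    forall (p : nat -> E) (xinfty : E),
      (forall k, P k (p k) = p k) ->
      p k @[k --> \oo] --> xinfty ->
      x k @[k --> \oo] --> xinfty).
Proof.
split=> [E P [M EM] [r r01 Pr]|E P [M EM] [r r01 Pr] x xP p a pP pa].
  have {}Pr k := contracting_le (Pr k).
  have {}EM k x y := mdist_le_diameter x y (EM k).
  split.
    have [x xP] := coherent_exists r01 Pr EM.
    by exists x; split=> // x'; exact: (coherent_unique r01 Pr EM).
  move=> x xP k; have xle := coherent_le r01 Pr EM xP.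
  have unif eps : 0 < eps -> exists N, forall n, (N <= n)%N ->
      forall y : E (n + k)%N, mdist (iterated_map P k n y) (x k) < eps.
    move=> /(geometric_lt M r01)[N NM]; exists N => n Nn y.
    by rewrite (le_lt_trans (xle _ _ _))// NM.
  split=> [y|eps /unif[N Nx]].
    apply/metricType_numDomainType.cvgrPdist_lt => eps /unif[N Nx].
    by exists N => // n /= Nn; rewrite metric_sym Nx.
  (* The threshold bears on the index [n + k] of the starting space, while [N] counts maps. *)
  by exists (N + k)%N => n; rewrite leq_add2r => /Nx.
apply: (coherent_cvg_fixpoints r01 _ _ xP pP pa) => [k|u v].
  exact: (contracting_le (Pr k)).
exact: mdist_le_diameter (EM 0).
Qed.
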